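(* Let $C_{(\neq,<)}(x,y)$ be the bivariate generating function of the Catalan words avoiding the ordered pair of relations $(\neq,<)$, where $x$ marks the length and $y$ marks the number of descents. Then $$C_{(\neq,<)}(x,y)=\frac{1 - x - x^2 - \sqrt{(1 - x - x^2)^2 - 4 x^3 y}}{2 x^3 y}.$$
   Context: A Catalan word of length $n$ is a word $w=w_1w_2\cdots w_n$ over the non-negative integers with $w_1=0$ and $0\leq w_i\leq w_{i-1}+1$ for $i=2,\dots,n$; the empty word is the unique Catalan word of length $0$. For relations $X,Y\in\{<,>,\leq,\geq,=,\neq\}$, a word $w$ contains the pattern $(X,Y)$ if there is an index $i\geq 1$ (with $i+2\le n$) such that $w_i\,X\,w_{i+1}$ and $w_{i+1}\,Y\,w_{i+2}$; otherwise $w$ avoids $(X,Y)$. The number of descents $\mathrm{des}(w)$ is the number of indices $i$ with $w_i>w_{i+1}$. The bivariate generating function is $C_{(X,Y)}(x,y)=\sum_{w}x^{|w|}y^{\mathrm{des}(w)}$, the sum being over all Catalan words $w$ (of any length $|w|\geq 0$) avoiding $(X,Y)$. Identities are between formal power series in $x$ with coefficients polynomials in $y$ (after clearing denominators); the square root of a power series with constant term $1$ is the one with constant term $1$. *)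

(* Defs.v *)
From HB Require Import structures.
From mathcomp Require Import all_boot all_order all_algebra.
From mathcomp Require Import boolp classical_sets.

Set Implicit Arguments.
Unset Strict Implicit.
Unset Printing Implicit Defensive.

Import GRing.Theory.
Local Open Scope ring_scope.

Record fps (R : Type) := Fps { fps_coef : nat -> R }.

HB.instance Definition _ (R : Type) := gen_eqMixin (fps R).
HB.instance Definition _ (R : Type) := gen_choiceMixin (fps R).

Lemma fpsP (R : Type) (f g : fps R) : fps_coef f =1 fps_coef g -> f = g.
Proof. by case: f g => [f] [g] /= /funext ->. Qed.

Section FpsRing.
Variable R : comNzRingType.
Implicit Types f g h : fps R.

Definition fps_const (c : R) : fps R := Fps (fun n => if n == 0%N then c else 0).
Definition fps_add f g := Fps (fun n => fps_coef f n + fps_coef g n).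
Definition fps_opp f := Fps (fun n => - fps_coef f n).
Definition fps_mul f g :=
  Fps (fun n => \sum_(i < n.+1) fps_coef f i * fps_coef g (n - i)).

Fact fps_addA : associative fps_add.
Proof. by move=> f g h; apply: fpsP => n /=; rewrite addrA. Qed.

Fact fps_addC : commutative fps_add.
Proof. by move=> f g; apply: fpsP => n /=; rewrite addrC. Qed.

Fact fps_add0 : left_id (fps_const 0) fps_add.
Proof. by move=> f; apply: fpsP => n /=; rewrite if_same add0r. Qed.

Fact fps_addN : left_inverse (fps_const 0) fps_opp fps_add.
Proof. by move=> f; apply: fpsP => n /=; rewrite if_same addNr. Qed.

HB.instance Definition _ := GRing.isZmodule.Build (fps R)
  fps_addA fps_addC fps_add0 fps_addN.

Let trunc n f : {poly R} := \poly_(i < n.+1) fps_coef f i.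

Let truncE n f i : (i <= n)%N -> (trunc n f)`_i = fps_coef f i.
Proof. by move=> le_in; rewrite coef_poly ltnS le_in. Qed.

Let mul_trunc n f g i : (i <= n)%N ->
  fps_coef (fps_mul f g) i = (trunc n f * trunc n g)`_i.
Proof.
move=> le_in; rewrite coefM; apply: eq_bigr => j _.
have le_ji : (j <= i)%N by rewrite -ltnS.
by rewrite !truncE ?(leq_trans le_ji) // (leq_trans (leq_subr _ _)).
Qed.

Fact fps_mulA : associative fps_mul.
Proof.
move=> f g h; apply: fpsP => n.
transitivity (trunc n f * trunc n g * trunc n h)`_n.
  rewrite -mulrA coefM; apply: eq_bigr => i _.
  have le_in : (i <= n)%N by rewrite -ltnS.
  by rewrite truncE // (@mul_trunc n) // leq_subr.
rewrite coefM; apply: eq_bigr => i _.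
have le_in : (i <= n)%N by rewrite -ltnS.
by rewrite (@mul_trunc n) // truncE // leq_subr.
Qed.

Fact fps_mulC : commutative fps_mul.
Proof.
by move=> f g; apply: fpsP => n; rewrite !(@mul_trunc n) // mulrC.
Qed.

Fact fps_mul1 : left_id (fps_const 1) fps_mul.
Proof.
move=> f; apply: fpsP => n /=; rewrite big_ord_recl /= mul1r subn0.
by rewrite big1 ?addr0 // => i _; rewrite mul0r.
Qed.

Fact fps_mulDl : left_distributive fps_mul fps_add.
Proof.
move=> f g h; apply: fpsP => n /=.
by rewrite -big_split; apply: eq_bigr => i _; rewrite mulrDl.
Qed.

Fact fps_1neq0 : fps_const 1 != fps_const 0.
Proof.
apply/eqP => /(congr1 (fun f => fps_coef f 0)) /= /eqP.
by rewrite oner_eq0.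
Qed.

HB.instance Definition _ := GRing.Zmodule_isComNzRing.Build (fps R)
  fps_mulA fps_mulC fps_mul1 fps_mulDl fps_1neq0.

Definition fps_X : fps R := Fps (fun n => (n == 1%N)%:R).

(* The series with constant term 1 whose square is f; it exists and is unique
   when f has constant term 1 and 2 is invertible (fps_sqrtP, fps_sqrt_uniq). *)
Definition fps_sqrt f : fps R :=
  xget 0 [set s : fps R | fps_coef s 0 = 1 /\ s ^+ 2 = f]%classic.

Lemma fps_coefD f g n : fps_coef (f + g) n = fps_coef f n + fps_coef g n.
Proof. by []. Qed.

Lemma fps_coefN f n : fps_coef (- f) n = - fps_coef f n.
Proof. by []. Qed.

Lemma fps_coefM f g n :
  fps_coef (f * g) n = \sum_(i < n.+1) fps_coef f i * fps_coef g (n - i).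
Proof. by []. Qed.

Lemma fps_coef0 n : fps_coef (0 : fps R) n = 0.
Proof. by rewrite /= if_same. Qed.

Lemma fps_coef1 n : fps_coef (1 : fps R) n = (n == 0%N)%:R.
Proof. by rewrite /=; case: eqP. Qed.

Lemma fps_coef_sqrS f n : fps_coef f 0 = 1 ->
  fps_coef (f ^+ 2) n.+1 =
  fps_coef f n.+1 *+ 2 + \sum_(i < n) fps_coef f i.+1 * fps_coef f (n - i).
Proof.
move=> f0; rewrite expr2 fps_coefM big_ord_recl big_ord_recr /= !subnn.
rewrite subn0 f0 mul1r mulr1 mulr2n -addrA; congr (_ + _).
by rewrite addrC.
Qed.

End FpsRing.

Section FpsSqrt.
Variable R : comUnitRingType.
Implicit Types f s t : fps R.
Hypothesis unit2 : (2%:R : R) \is a GRing.unit.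

Lemma fps_sqrt_uniq s t : fps_coef s 0 = 1 -> fps_coef t 0 = 1 ->
  s ^+ 2 = t ^+ 2 -> s = t.
Proof.
move=> s0 t0 eq_st; apply: fpsP => n.
have [k] := ubnP n; elim: k n => // k IHk [|n] lt_nk; first by rewrite s0 t0.
have := congr1 (fun f => fps_coef f n.+1) eq_st.
rewrite !fps_coef_sqrS //.
set a := \sum_(_ < _) _; set b := \sum_(_ < _) _.
have -> : a = b.
  apply: eq_bigr => i _; congr (_ * _); apply: IHk.
    exact: leq_ltn_trans (ltn_ord i) lt_nk.
  exact: (@leq_ltn_trans n) (leq_subr _ _) lt_nk.
move/addIr; rewrite -[LHS]mulr_natr -[RHS]mulr_natr.
exact: (mulIr unit2).
Qed.

Lemma fps_sqrt_exists f : fps_coef f 0 = 1 ->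
  exists s, fps_coef s 0 = 1 /\ s ^+ 2 = f.
Proof.
move=> f0.
pose step n (u : nat -> R) i : R := if (i <= n)%N then u i else
  (fps_coef f n.+1 - \sum_(j < n) u j.+1 * u (n - j)%N) / 2%:R.
pose u := fix u n := if n is n'.+1 then step n' (u n') else fun=> 1 : R.
have uE n i : (i <= n)%N -> u n i = u i i.
  elim: n => [|n IHn]; first by rewrite leqn0 => /eqP ->.
  rewrite leq_eqVlt => /predU1P[-> // | lt_in].
  by rewrite /= {1}/step -ltnS lt_in IHn.
exists (Fps (fun n => u n n)); split=> //; apply: fpsP => -[|n].
  by rewrite expr2 fps_coefM big_ord1 /= f0 mulr1.
rewrite fps_coef_sqrS //= {1}/step ltnn.
rewrite -[X in X + _]mulr_natr divrK //.
rewrite -[RHS](addrNK (\sum_(j < n) u n j.+1 * u n (n - j)%N)).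
congr (_ + _); apply: eq_bigr => i _.
by rewrite !uE // ?leq_subr.
Qed.

Lemma fps_sqrtP f : fps_coef f 0 = 1 ->
  fps_coef (fps_sqrt f) 0 = 1 /\ fps_sqrt f ^+ 2 = f.
Proof.
by move=> /fps_sqrt_exists; rewrite /fps_sqrt => /(@xgetPex _ 0).
Qed.

End FpsSqrt.

Lemma polyrat_unit2 : (2%:R : {poly rat}) \is a GRing.unit.
Proof. by rewrite -polyC_natr poly_unitE coefC size_polyC /= unitfE. Qed.

Definition catalan_word (w : seq nat) : bool :=
  (head 0%N w == 0%N) && sorted (fun a b => (b <= a.+1)%N) w.

Definition contains_rel (X Y : rel nat) (w : seq nat) : bool :=
  has (fun i => X (nth 0%N w i) (nth 0%N w i.+1)
             && Y (nth 0%N w i.+1) (nth 0%N w i.+2)) (iota 0 (size w - 2)).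

Definition avoids_rel (X Y : rel nat) (w : seq nat) : bool :=
  ~~ contains_rel X Y w.

Definition des (w : seq nat) : nat :=
  count (fun i => (nth 0%N w i.+1 < nth 0%N w i)%N) (iota 0 (size w - 1)).

(* Letters of a Catalan word of length n are smaller than n, so that the Catalan
   words of length n can be enumerated as tuples over 'I_n. *)
Lemma catalan_word_lt (w : seq nat) :
  catalan_word w -> all (fun a => (a < size w)%N) w.
Proof.
move=> /andP[w0 /(sortedP 0%N) w_step]; apply/(all_nthP 0%N) => i lt_iw.
suff: (nth 0%N w i <= i)%N by move/leq_ltn_trans; apply.
elim: i lt_iw => [|i IHi] lt_iw; first by rewrite nth0 (eqP w0).
by rewrite (leq_trans (w_step i lt_iw)) // ltnS IHi // ltnW.
Qed.

(* The power series variable marks the length, the polynomial variable 'X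
   marks the descents. *)
Definition catalan_gf (X Y : rel nat) : fps {poly rat} :=
  Fps (fun n => \sum_(w : n.-tuple 'I_n |
                      catalan_word (map val w) && avoids_rel X Y (map val w))
                  'X^(des (map val w))).

(* Main.v *)
(** Read a Catalan word from left to right, remembering the current letter [h]
    and whether an ascent is allowed now (it is at the first letter and after an
    equality).  Let [P_h] and [Q_h] be the series of the continuations from [h]
    with ascents allowed, resp. forbidden, for the next letter.  A continuation
    from [h] first stays at or above [h], as a continuation from [0] does, and
    then stops or descends to some [j < h]; so with
    [S_h = 1 + x y \sum_(j < h) Q_j] one expects [P_h = P_0 S_h] and
    [Q_h = (1 + x P_0) S_h].  The transfer equations show that the defect
    [P_h - P_0 S_h] is divisible by arbitrary powers of [x], hence vanishes; the
    case [h = 0] then gives [C = 1 + x C + x^2 C + x^3 y C^2] for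
    [C = 1 + x P_0]. *)
Require Import Defs.
From mathcomp Require Import all_boot all_order all_algebra.
From mathcomp Require Import ring zify.
Import GRing.Theory.
Local Open Scope ring_scope.

(** * Words read letter by letter *)

Lemma big_tuple_cons (R : nmodType) (T : finType) n (F : n.+1.-tuple T -> R) :
  \sum_w F w = \sum_a \sum_(t : n.-tuple T) F [tuple of a :: t].
Proof.
rewrite pair_big /=.
rewrite (reindex (fun p : T * n.-tuple T => [tuple of p.1 :: p.2])) //=.
exists (fun w => (thead w, [tuple of behead w])) => [[a t] | w] _ /=.
  by congr (_, _); apply/val_inj.
by rewrite -tuple_eta.
Qed.

Lemma des_cons2 p q s : des [:: p, q & s] = ((q < p) + des (q :: s))%N.
Proof.
rewrite /des /= !subSS !subn0 /= (iotaDl 1 0) count_map.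
by congr (_ + _)%N; apply: eq_count.
Qed.

(** For empty [s] the default [q] makes the test [Y q q], which irreflexivity rejects: two letters
    contain no pattern. *)
Lemma avoids_rel_cons2 (X Y : rel nat) p q s : irreflexive Y ->
  avoids_rel X Y [:: p, q & s] =
  ~~ (X p q && Y q (head q s)) && avoids_rel X Y (q :: s).
Proof.
move=> Yirr; rewrite /avoids_rel /contains_rel.
case: s => [|r s] /=; first by rewrite Yirr andbF.
rewrite !subSS !subn0 /= (iotaDl 1 0) has_map negb_or.
by congr (_ && ~~ _); apply: eq_has.
Qed.

(* [h] is the letter before [s]; [a] tells whether [s] may start with an ascent. *)
Fixpoint wt (a : bool) (h : nat) (s : seq nat) : {poly rat} :=
  if s is k :: s' then
    if (k < h)%N then 'X * wt false k s' else
    if k == h then wt true h s' else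
    if k == h.+1 then (if a then wt false k s' else 0) else 0
  else 1.

(** Ties the recursion to the global conditions: after a strict step the next letter must not
    ascend, which is what the flag [false] imposes. The default [h] lets an empty [s] pass. *)
Lemma wtE a h s :
  wt a h s =
  if [&& path (fun a b => (b <= a.+1)%N) h s,
         avoids_rel (fun a b => a != b) (fun a b => (a < b)%N) (h :: s)
       & a || (head h s <= h)%N]
  then 'X^(des (h :: s)) else 0.
Proof.
elim: s a h => [|k s IHs] a h; first by rewrite /= leqnn orbT.
rewrite /= avoids_rel_cons2; last exact: ltnn.
rewrite des_cons2 !IHs.
case: (ltngtP k h) => [lt_kh | lt_hk | ->] /=.
- rewrite (leqW (ltnW lt_kh)) orbT /= -leqNgt.
  rewrite andbT (andbC (head _ _ <= _)%N).
  by case: ifP; rewrite ?exprS ?mulr0.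
- rewrite -leqNgt orbF add0n.
  case: eqP => [-> | ne]; last by rewrite leqNgt (_ : (h.+1 < k)%N) //; lia.
  by case: a; rewrite ?andbF //= ltnSn andbT (andbC (head _ _ <= _)%N).
- by rewrite leqnSn orbT !andbT add0n.
Qed.

(** The coefficient of x^n in P_h ([a] true) or Q_h ([a] false). *)
Fixpoint cont_poly (n : nat) (a : bool) (h : nat) : {poly rat} :=
  if n is n'.+1 then
    cont_poly n' true h + (if a then cont_poly n' false h.+1 else 0)
    + 'X * \sum_(j < h) cont_poly n' false j
  else 1.

(** Letters grow by at most one per step, so the bound keeps them all below [M] and the finite
    alphabet loses no word. *)
Lemma sum_wt M n a h : (h + n < M)%N ->
  \sum_(t : n.-tuple 'I_M) wt a h (map val t) = cont_poly n a h.
Proof.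
elim: n a h => [|n IHn] a h ltM.
  rewrite (bigD1 [tuple]) //= big1 ?addr0 // => t.
  by case/eqP; rewrite tuple0.
rewrite big_tuple_cons /=.
pose G a k := \sum_(t : n.-tuple 'I_M) wt a k (map val t).
transitivity (\sum_(k < M)
    if (k < h)%N then 'X * G false k else
    if k == h :> nat then G true h else
    if k == h.+1 :> nat then (if a then G false h.+1 else 0) else 0).
  apply: eq_bigr => k _; case: ifP => _; first by rewrite -mulr_sumr.
  case: ifP => _ //; case: eqP => [->|_]; last by rewrite big1.
  by case: a => //; rewrite big1.
(* As a sum over a range of naturals it can be cut at [h], separating descents, equality and
   ascent. *)
rewrite -(big_mkord xpredT (fun k =>
    if (k < h)%N then 'X * G false k else
    if k == h :> nat then G true h else
    if k == h.+1 :> nat then (if a then G false h.+1 else 0) else 0)).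
rewrite (@big_cat_nat _ _ _ h) //=; last by lia.
rewrite (big_ltn (m := h)); last by lia.
rewrite (big_ltn (m := h.+1)); last by lia.
rewrite ltnn eqxx ltnNge leqnSn /= (gtn_eqF (ltnSn h)) eqxx.
rewrite [X in _ + (_ + (_ + X))]big_nat.
rewrite [X in _ + (_ + (_ + X))]big1 ?addr0; last first.
  by move=> i /andP[lti _]; do 3!(case: ifP => [?|_]; first by lia).
rewrite addrC; congr (_ + _ + _).
- by apply: IHn; lia.
- by case: a => //; apply: IHn; lia.
- rewrite mulr_sumr big_mkord; apply: eq_bigr => j _.
  by rewrite ltn_ord /G IHn //; have := ltn_ord j; lia.
Qed.

Lemma catalan_gf_coef0 X Y : fps_coef (catalan_gf X Y) 0 = 1.
Proof.
rewrite /= (bigD1 [tuple]) //= big1 ?addr0 // => t.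
by case/andP=> _ /eqP[]; rewrite tuple0.
Qed.

Lemma catalan_gf_coefS n :
  fps_coef (catalan_gf (fun a b => a != b) (fun a b => (a < b)%N)) n.+1
  = cont_poly n true 0.
Proof.
rewrite /= big_mkcond big_tuple_cons /= big_ord_recl.
rewrite [X in _ + X]big1 ?addr0 => [|i _]; last by rewrite big1.
rewrite -(@sum_wt n.+1) //; apply: eq_bigr => t _.
by rewrite wtE /catalan_word /= andbT.
Qed.

(** * Coefficients of power series *)

Lemma fps_coefXM0 (R : comNzRingType) (f : fps R) :
  fps_coef (fps_X R * f) 0 = 0.
Proof. by rewrite fps_coefM big_ord1 mul0r. Qed.

Lemma fps_coefXMS (R : comNzRingType) (f : fps R) n :
  fps_coef (fps_X R * f) n.+1 = fps_coef f n.
Proof.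
rewrite fps_coefM big_ord_recl /= mul0r add0r big_ord_recl /= mul1r /bump /= subn1 big1 ?addr0 //.
by move=> i _; rewrite mul0r.
Qed.

Lemma fps_coefCM (R : comNzRingType) c (f : fps R) n :
  fps_coef (fps_const c * f) n = c * fps_coef f n.
Proof.
rewrite fps_coefM big_ord_recl /= subn0 big1 ?addr0 //.
by move=> i _; rewrite mul0r.
Qed.

Lemma fps_coef_sum (R : comNzRingType) m (f : nat -> fps R) n :
  fps_coef (\sum_(j < m) f j) n = \sum_(j < m) fps_coef (f j) n.
Proof.
elim: m => [|m IHm]; first by rewrite !big_ord0 fps_coef0.
by rewrite !big_ord_recr fps_coefD IHm.
Qed.

Lemma fps_eq0_dvdX (R : comNzRingType) (f : fps R) :
  (forall n, exists g, f = fps_X R ^+ n * g) -> f = 0.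
Proof.
move=> f_dvd; apply: fpsP => n; rewrite fps_coef0.
have [g ->] := f_dvd n.+1.
elim: n {f f_dvd} => [|n IHn]; first by rewrite expr1 fps_coefXM0.
by rewrite exprS -mulrA fps_coefXMS.
Qed.

(** * Transfer equations and the quadratic equation *)

Section Transfer.

Let x : fps {poly rat} := fps_X {poly rat}.
Let y : fps {poly rat} := fps_const 'X.
Let P h := Fps (fun n => cont_poly n true h).
Let Q h := Fps (fun n => cont_poly n false h).
Let S h := 1 + x * (y * \sum_(j < h) Q j).

Let P_eq h : P h = S h + x * P h + x * Q h.+1.
Proof.
apply: fpsP => -[|n]; rewrite !fps_coefD fps_coef1.
  by rewrite !fps_coefXM0 /= !addr0.
by rewrite !fps_coefXMS fps_coefCM fps_coef_sum /=; ring.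
Qed.

Let Q_eq h : Q h = S h + x * P h.
Proof.
apply: fpsP => -[|n]; rewrite !fps_coefD fps_coef1.
  by rewrite !fps_coefXM0 /= !addr0.
by rewrite !fps_coefXMS fps_coefCM fps_coef_sum /=; ring.
Qed.

Let S0 : S 0 = 1.
Proof. by rewrite /S big_ord0 !mulr0 addr0. Qed.

Let SS h : S h.+1 = S h + x * y * Q h.
Proof. by rewrite /S big_ord_recr /=; ring. Qed.

Let C := 1 + x * P 0.
Let D h := P h - P 0 * S h.

Let Q_D h : Q h = C * S h + x * D h.
Proof. by rewrite Q_eq /C /D; ring. Qed.

Let D0 : D 0 = 0.
Proof. by rewrite /D S0 mulr1 subrr. Qed.

Let P0_eq : P 0 = 1 + x * P 0 + x * C + x ^+ 2 * y * C ^+ 2 + x ^+ 2 * D 1.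
Proof. by rewrite {1}P_eq Q_D SS Q_D D0 S0; ring. Qed.

Let D_eq h :
  D h = x * (D h + x * D h.+1 + x ^+ 2 * y * C * D h - x * S h * D 1).
Proof.
have PE : P h = D h + P 0 * S h by rewrite subrK.
(* [P h] is expanded by the transfer equations and the factor [P 0] of [S h] by [P0_eq]; the terms
   free of defects then cancel. *)
transitivity (S h + x * P h
    + x * (C * (S h + x * y * (C * S h + x * D h)) + x * D h.+1)
    - (1 + x * P 0 + x * C + x ^+ 2 * y * C ^+ 2 + x ^+ 2 * D 1) * S h).
  by rewrite -P0_eq -Q_D -SS -Q_D -P_eq.
by rewrite PE; ring.
Qed.

Let D_eq0 h : D h = 0.
Proof.
apply: fps_eq0_dvdX => n; elim: n h => [|n IHn] h.
  by exists (D h); rewrite expr0 mul1r.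
(* The outer factor [x] in [D_eq] raises the common power of [x] by one. *)
have [[g0 E0] [g1 E1] [g2 E2]] := And3 (IHn h) (IHn h.+1) (IHn 1%N).
exists (g0 + x * g1 + x ^+ 2 * y * C * g0 - x * S h * g2).
by rewrite D_eq E0 E1 E2 -/x (exprS x n); ring.
Qed.

Lemma catalan_gf_neq_lt_quadratic :
  let G := catalan_gf (fun a b => a != b) (fun a b => (a < b)%N) in
  G = 1 + x * G + x ^+ 2 * G + x ^+ 3 * y * G ^+ 2.
Proof.
move=> G; have -> : G = C.
  apply: fpsP => -[|n]; rewrite fps_coefD fps_coef1.
    by rewrite fps_coefXM0 catalan_gf_coef0 addr0.
  by rewrite fps_coefXMS catalan_gf_coefS add0r.
by rewrite {1}/C P0_eq D_eq0 /C; ring.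
Qed.

End Transfer.

Theorem theorem3p42 :
  let x : fps {poly rat} := fps_X {poly rat} in
  let y : fps {poly rat} := fps_const 'X in
  2%:R * x ^+ 3 * y * catalan_gf (fun a b => a != b) (fun a b => (a < b)%N) =
  1 - x - x ^+ 2 - fps_sqrt ((1 - x - x ^+ 2) ^+ 2 - 4%:R * x ^+ 3 * y).
Proof.
move=> x y; have := catalan_gf_neq_lt_quadratic.
set G := catalan_gf _ _ => /=; rewrite -/x -/y => G_eq.
have coef0_xD (f g : fps {poly rat}) : fps_coef (f + x * g) 0 = fps_coef f 0.
  by rewrite fps_coefD fps_coefXM0 addr0.
have [s0 sE] : fps_coef (fps_sqrt ((1 - x - x ^+ 2) ^+ 2 - 4%:R * x ^+ 3 * y)) 0
    = 1 /\ fps_sqrt ((1 - x - x ^+ 2) ^+ 2 - 4%:R * x ^+ 3 * y) ^+ 2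
    = (1 - x - x ^+ 2) ^+ 2 - 4%:R * x ^+ 3 * y.
  apply: (fps_sqrtP polyrat_unit2).
  rewrite (_ : _ - _ = 1 + x * (x * (1 + x) ^+ 2 - 2%:R * (1 + x)
    - 4%:R * x ^+ 2 * y)); last by ring.
  by rewrite coef0_xD fps_coef1.
(* Completing the square in the quadratic equation suggests this root; its constant term 1 fixes the
   sign. *)
rewrite -(fps_sqrt_uniq polyrat_unit2
  (s := 1 - x - x ^+ 2 - 2%:R * x ^+ 3 * y * G) _ s0); first by ring.
- rewrite (_ : _ - _ = 1 + x * (- 1 - x - 2%:R * x ^+ 2 * y * G)); last by ring.
  by rewrite coef0_xD fps_coef1.
- rewrite sE; apply/eqP; rewrite -subr_eq0; apply/eqP.
  transitivity (4%:R * x ^+ 3 * y *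
    ((1 + x * G + x ^+ 2 * G + x ^+ 3 * y * G ^+ 2) - G)); first by ring.
  by rewrite -G_eq subrr mulr0.
Qed.
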